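(* Let $(X_t)_{t \in \mathbb{N}}$ be a random process over $\mathbb{R}$, let $x_{\min} > 0$, and let $T = \inf\{t \mid X_t < x_{\min}\}$. Furthermore, suppose that (a) $X_0 \geq x_{\min}$ and, for all $t \leq T$, it holds that $X_t \geq 0$, and that (b) there is some value $\delta > 0$ such that, for all $t < T$, it holds that $X_t - \mathrm{E}[X_{t+1} \mid X_0, \ldots, X_t] \geq \delta X_t$. Then $$\mathrm{E}[T \mid X_0] \leq \frac{1 + \ln\left(\frac{X_0}{x_{\min}}\right)}{\delta}.$$
   Context: $\mathbb{N}$ includes $0$. $\inf\emptyset := \infty$, so $T$ takes values in $\mathbb{N} \cup \{\infty\}$. Conditional expectations given $X_0,\ldots,X_t$ (respectively $X_0$) are random variables, taken with respect to the $\sigma$-algebra generated by these variables; (in)equalities between random variables are understood almost surely. Since $T$ is a random variable, a requirement stated ''for all $t < T$'' (respectively ''for all $t \le T$'') means formally that, for every $t \in \mathbb{N}$, both sides of the inequality are multiplied by the indicator function of the event $\{t < T\}$ (respectively $\{t \le T\}$); i.e., the inequality only has to hold on that event. *)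

(* Defs.v *)
(* MathComp / MathComp-Analysis *)
From mathcomp Require Import all_boot all_order all_algebra.
From mathcomp Require Import all_classical all_reals all_analysis.
From mathcomp Require Import measurable_realfun.

Set Implicit Arguments.
Unset Strict Implicit.
Unset Printing Implicit Defensive.

Import Order.TTheory GRing.Theory Num.Theory.

Local Open Scope classical_set_scope.
Local Open Scope ring_scope.
Local Open Scope ereal_scope.

Section conditional_expectation.
Context {d : measure_display} {Omega : measurableType d} {R : realType}.
Variable P : probability Omega R.

(* [G] is meant to be a sub-sigma-algebra of the events. Neither [Y] nor [Z]
   is required to be integrable: both sides of the defining identity are
   well-defined in [0, +oo] for a nonnegative random variable [Y], and the
   identity forces [Z] to be nonnegative almost surely. *)
Definition is_condexp_ge0 (G : set (set Omega)) (Y Z : Omega -> \bar R) :=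
  (forall B : set (\bar R), measurable B -> G (Z @^-1` B)) /\
  (forall A : set Omega, G A -> \int[P]_(w in A) Z w = \int[P]_(w in A) Y w).

(* [Z] is a version of E[Y | G] := E[Y^+ | G] - E[Y^- | G]. For integrable [Y]
   this is the usual conditional expectation. In general, the difference is
   meaningful wherever E[Y^+ | G] or E[Y^- | G] is finite; elsewhere [Z] takes
   the conventional value of +oo - +oo and carries no information. *)
Definition is_condexp (G : set (set Omega)) (Y Z : Omega -> \bar R) :=
  exists Zp Zn : Omega -> \bar R,
    [/\ is_condexp_ge0 G Y^\+ Zp,
        is_condexp_ge0 G Y^\- Zn
      & forall w, Z w = Zp w - Zn w].

End conditional_expectation.

Section process.
Context {d : measure_display} {Omega : measurableType d} {R : realType}.

(* the sigma-algebra generated by X_0, ..., X_t *)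
Definition history (X : nat -> Omega -> R) (t : nat) : set (set Omega) :=
  g_sigma_preimage (fun i : 'I_t.+1 => X i).

(* [ereal_inf set0 = +oo] *)
Definition first_below (X : nat -> Omega -> R) (a : R) (w : Omega) : \bar R :=
  ereal_inf [set t%:R%:E | t in [set t : nat | (X t w < a)%R]].

End process.

(* Main.v *)
Require Import Defs.
From mathcomp Require Import all_boot all_order all_algebra.
From mathcomp Require Import all_classical all_reals all_analysis.
From mathcomp Require Import measurable_realfun.
From mathcomp Require Import ring lra.

Set Implicit Arguments.
Unset Strict Implicit.
Unset Printing Implicit Defensive.

Import Order.TTheory GRing.Theory Num.Theory.

Local Open Scope classical_set_scope.
Local Open Scope ring_scope.
Local Open Scope ereal_scope.

(** Write S_t for the event that X_0, ..., X_t are all at least x_min, which is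
    the event t < T, and consider the potential
      V_t = (1 + ln (X_t / x_min)) 1_{S_t}.
    On S_t, with x = X_t and y = X_{t+1} >= 0, the potential falls by at least
    1 - y / x. If y >= x_min this is ln (y / x) <= y / x - 1. If y < x_min the
    potential falls from at least 1 to 0; the summand 1 pays for this jump.
    Hence, almost surely,
      V_{t+1} + 1_{S_t} <= V_t + (1_{S_t} / X_t) X_{t+1}   [potential_drop].

    The weight 1_{S_t} / X_t is known at time t, so when integrating over an
    event of the history up to t one may replace X_{t+1} by its conditional
    expectation Z_t [ge0_integral_mul_sub], and the drift hypothesis says that
    1_{S_t} Z_t / X_t <= (1 - delta) 1_{S_t}. This gives
      int_A V_{t+1} + delta P(A and S_t) <= int_A V_t
    for every such event A [integral_potential_step]. For A in the
    sigma-algebra of X_0 these inequalities telescope, and since T is the sum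
    of the indicators 1_{S_t} [first_below_series], they add up to
      delta int_A T <= int_A V_0   [integral_first_below_le].
    As A is arbitrary, E[T | X_0] <= V_0 / delta almost surely
    [ae_le_of_integral_le], and V_0 = 1 + ln (X_0 / x_min).

    No integrability is assumed, so conditional expectations are handled as
    extended-real densities of nonnegative variables: the negative part of
    X_{t+1} contributes nothing on S_t [condexp_ge0_null], and all other
    integrands are nonnegative. The inequalities between integrals are sums of
    nonnegative terms, infinite values included, and only finite terms such as
    P(A and S_t) are ever cancelled. *)

(** * Conditional expectations of nonnegative variables *)

Section sub_sigma_algebra.
Import HBSimple HBNNSimple.
Context {d : measure_display} {Omega : measurableType d} {R : realType}.
Variables (P : probability Omega R) (G : set (set Omega)).
Hypothesis sG : <<s G >> `<=` (measurable : set (set Omega)).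
Implicit Types (Y Z h : Omega -> \bar R) (A : set Omega).

Local Notation sub := (g_sigma_algebraType G).

Lemma measurable_fun_sub d' (U : measurableType d') (f : Omega -> U) :
  measurable_fun [set: sub] (f : sub -> U) -> measurable_fun setT f.
Proof. by move=> mf _ B mB; apply: sG; apply: mf. Qed.

Lemma condexp_measurable Y Z : is_condexp_ge0 P <<s G >> Y Z ->
  measurable_fun [set: sub] (Z : sub -> \bar R).
Proof. by move=> [mZ _] _ B mB; rewrite setTI; apply: mZ. Qed.

(** Pulling out a known factor: [h] is an increasing limit of simple functions
    whose level sets are events of the sub-sigma-algebra, and on such events
    the integrals of [Y] and [Z] agree. *)
Lemma ge0_integral_mul_sub Y Z h A :
  measurable_fun setT Y -> measurable_fun setT Z ->
  (forall w, 0 <= Y w) -> (forall w, 0 <= Z w) ->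
  measurable_fun [set: sub] (h : sub -> \bar R) -> (forall w, 0 <= h w) ->
  <<s G >> A ->
  (forall B, <<s G >> B -> \int[P]_(w in B) Z w = \int[P]_(w in B) Y w) ->
  \int[P]_(w in A) (h w * Z w) = \int[P]_(w in A) (h w * Y w).
Proof.
move=> mY mZ Y0 Z0 mh h0 GA ZY.
have mA : measurable A by exact: sG.
pose hn := nnsfun_approx (@measurableT _ sub) mh.
have hn0 n w : (0 <= hn n w)%R by apply: fun_ge0.
have mhn n : measurable_fun setT (fun w : Omega => (hn n w)%:E).
  by apply: measurable_fun_sub; apply/measurable_EFinP; apply: measurable_funP.
have hn_h w : (hn n w)%:E @[n --> \oo] --> h w.
  exact: (@cvg_nnsfun_approx _ sub R setT measurableT h mh).
have hn_nd w (n m : nat) : (n <= m)%N -> (hn n w <= hn m w)%R.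
  by move=> nm; apply/lefP: w; apply: nd_nnsfun_approx.
(* both sides are limits of the integrals against the simple functions *)
have lim_int V : measurable_fun setT V -> (forall w, 0 <= V w) ->
    \int[P]_(w in A) (h w * V w) =
    limn (fun n => \int[P]_(w in A) ((hn n w)%:E * V w)).
  move=> mV V0; rewrite -monotone_convergence //.
  - apply: eq_integral => w _; apply/esym/cvg_lim => //.
    have [Vfin|Vinf] := boolP (V w \is a fin_num); first exact: cvgeZr.
    have [hw0|hw0] := eqVneq (h w) 0.
      (* the approximations of h vanish with h *)
      have hnw0 n : (hn n w)%:E = 0.
        apply/eqP; rewrite eq_le [X in _ && X]lee_fin hn0 andbT -hw0.
        rewrite -(cvg_lim _ (hn_h w))//; apply: lime_ge.
          by apply: cvgP; exact: hn_h.
        by exists n => // m /= nm; rewrite lee_fin hn_nd.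
      under eq_fun do rewrite hnw0 mul0e.
      by rewrite hw0 mul0e; apply: cvg_cst.
    apply: cvgeM; [|exact: hn_h|exact: cvg_cst].
    exact: mule_def_neq0_infty.
  - by move=> n; apply: measurable_funTS; apply: emeasurable_funM.
  - by move=> n w _; rewrite mule_ge0// lee_fin.
  - by move=> w _ n m nm; rewrite lee_wpmul2r// lee_fin hn_nd.
rewrite !lim_int//; congr (limn _); apply/funext => n.
have expand V : measurable_fun setT V -> (forall w, 0 <= V w) ->
    \int[P]_(w in A) ((hn n w)%:E * V w) =
    \sum_(y \in range (hn n))
      (y%:E * \int[P]_(w in A `&` hn n @^-1` [set y]) V w).
  move=> mV V0.
  have y1_ge0 y w : 0 <= (y * \1_(hn n @^-1` [set y]) w)%:E.
    exact: nnfun_muleindic_ge0.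
  transitivity (\int[P]_(w in A) (\sum_(y \in range (hn n))
      ((y * \1_(hn n @^-1` [set y]) w)%:E * V w))).
    apply: eq_integral => w _.
    by rewrite -ge0_mule_fsuml// fsumEFin// -fimfunE.
  have m1 y : measurable (hn n @^-1` [set y] : set Omega).
    apply: sG; rewrite -[X in <<s _ >> X]setTI.
    exact: (@measurable_funP _ _ sub _ setT (hn n) measurableT).
  rewrite ge0_integral_fsum//; last 2 first.
  - move=> y; apply: emeasurable_funM; last exact: measurable_funTS.
    by apply/measurable_EFinP; apply: measurable_funM.
  - by move=> y w _; rewrite mule_ge0.
  apply: eq_fsbigr => y; rewrite inE => -[w0 _ <-].
  under eq_integral do rewrite EFinM -muleA.
  rewrite ge0_integralZl//.
  - rewrite integral_mkcondr; congr (_ * _); apply: eq_integral => w _.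
    by rewrite epatch_indic muleC.
  - apply: emeasurable_funM; last exact: measurable_funTS.
    by apply/measurable_EFinP.
  - by move=> w _; rewrite mule_ge0// lee_fin.
  - by rewrite lee_fin.
rewrite (expand Z)// (expand Y)//; apply: eq_fsbigr => y _; rewrite ZY//.
exact: (@measurableI _ sub).
Qed.

(** Test the defining identity on the event where [Z] is negative. *)
Lemma condexp_ge0_ae Y Z : (forall w, 0 <= Y w) ->
  is_condexp_ge0 P <<s G >> Y Z -> {ae P, forall w, 0 <= Z w}.
Proof.
move=> Y0 YZ; have mZs := condexp_measurable YZ; case: YZ => _ ZY.
have mZ := measurable_fun_sub mZs.
pose A := [set w | Z w < 0].
have GA : <<s G >> A.
  have := @emeasurable_fun_infty_o _ sub R setT Z measurableT mZs 0.
  by rewrite setTI.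
have mA : measurable A by exact: sG.
have : \int[P]_(w in A) `|Z w| = 0.
  rewrite (eq_integral (fun w => - Z w)); last first.
    by move=> w; rewrite inE => /lte0_abs.
  apply/eqP; rewrite eq_le integral_ge0 ?andbT; last first.
    by move=> w /ltW; rewrite oppe_ge0.
  rewrite -oppe_ge0 -integral_ge0N; last by move=> w /ltW; rewrite oppe_ge0.
  by under eq_integral do rewrite oppeK; rewrite ZY// integral_ge0.
move/(ae_eq_integral_abs P mA (measurable_funTS mZ)).
apply: filterS => w Aw; rewrite leNgt; apply/negP => Zw.
by have := Aw Zw; move: Zw => /[swap] ->; rewrite ltxx.
Qed.

(** Provides a version that is nonnegative everywhere, as required by the
    monotone approximation in [ge0_integral_mul_sub]. *)
Lemma condexp_ge0_funepos Y Z : (forall w, 0 <= Y w) ->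
  is_condexp_ge0 P <<s G >> Y Z -> is_condexp_ge0 P <<s G >> Y Z^\+.
Proof.
move=> Y0 YZ; have mZs := condexp_measurable YZ.
have Z0 := condexp_ge0_ae Y0 YZ; have mZ := measurable_fun_sub mZs.
case: YZ => _ ZY; split=> [B mB|A GA].
  rewrite -(setTI (_ @^-1` _)).
  exact: (@measurable_funepos _ sub R setT Z).
rewrite -ZY//; apply: ae_eq_integral.
- exact: sG.
- by apply: measurable_funTS; apply: measurable_funepos.
- exact: measurable_funTS.
- by apply: filterS Z0 => w Zw _; rewrite funeposE; apply/max_idPl.
Qed.

Lemma condexp_ge0_null Y Z A : (forall w, 0 <= Y w) -> measurable_fun setT Y ->
  is_condexp_ge0 P <<s G >> Y Z -> <<s G >> A ->
  {ae P, forall w, A w -> Y w = 0} -> {ae P, forall w, A w -> Z w = 0}.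
Proof.
move=> Y0 mY YZ GA YA; have mA : measurable A by exact: sG.
have mZ := measurable_fun_sub (condexp_measurable YZ).
have : \int[P]_(w in A) `|Z^\+ w| = 0.
  rewrite (eq_integral Z^\+); last first.
    by move=> w _; rewrite gee0_abs// funepos_ge0.
  case: (condexp_ge0_funepos Y0 YZ) => _ ->//.
  rewrite (ae_eq_integral (cst 0))//; first exact: integral0.
  exact: measurable_funTS.
move/(ae_eq_integral_abs P mA (measurable_funTS (measurable_funepos mZ))).
apply: filterS2 (condexp_ge0_ae Y0 YZ) => w Zw ZA Aw.
by have := ZA Aw; rewrite funeposE (max_idPl Zw).
Qed.

(** On the event where [f < Z] and [f <= n] the integral of [f] is finite, so it
    can be cancelled from that of [Z = f + (Z - f)]; the positive function
    [Z - f] then has integral zero, and the event is null. *)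
Lemma ae_le_of_integral_le Z (f : Omega -> R) :
  measurable_fun [set: sub] (Z : sub -> \bar R) ->
  measurable_fun [set: sub] (f : sub -> R) ->
  (forall w, 0 <= f w)%R ->
  (forall A, <<s G >> A ->
    \int[P]_(w in A) Z w <= \int[P]_(w in A) (f w)%:E) ->
  {ae P, forall w, Z w <= (f w)%:E}.
Proof.
move=> mZs mfs f0 Zf.
have mZ := measurable_fun_sub mZs; have mf := measurable_fun_sub mfs.
have mEf : measurable_fun setT (EFin \o f) by apply/measurable_EFinP.
pose A n := [set w | (f w)%:E < Z w] `&` [set w | (f w <= n%:R)%R].
have GA n : <<s G >> (A n).
  have mfZ : measurable_fun [set: sub] (fun w : sub => (f w)%:E < Z w).
    by apply: measurable_fun_lte => //; apply/measurable_EFinP.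
  have mfn : measurable_fun [set: sub] (fun w : sub => (f w <= n%:R)%R).
    exact: measurable_fun_ler.
  have := @measurableI _ sub _ _ (mfZ measurableT [set true] I)
    (mfn measurableT [set true] I).
  by rewrite !setTI !preimage_true.
have mA n : measurable (A n) by exact: sG.
have Anull n : {ae P, forall w, ~ A n w}.
  have intf : \int[P]_(w in A n) (f w)%:E < +oo.
    apply: (@le_lt_trans _ _ (\int[P]_(w in A n) (cst n%:R%:E w))).
      apply: ge0_le_integral => //.
      - by move=> w _; rewrite lee_fin.
      - exact: measurable_funTS.
      - by move=> w [_]; rewrite lee_fin.
    by rewrite integral_cst// ltey_eq fin_numM// fin_num_measure.
  pose D w := Z w - (f w)%:E.
  have D0 w : A n w -> 0 <= D w by move=> [/ltW fZ _]; rewrite sube_ge0.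
  have mD : measurable_fun (A n) D.
    by apply: measurable_funTS; apply: emeasurable_funB.
  have : \int[P]_(w in A n) `|D w| = 0.
    rewrite (eq_integral D); last first.
      by move=> w; rewrite inE => /D0; apply: gee0_abs.
    apply/eqP; rewrite eq_le integral_ge0// andbT.
    have := Zf _ (GA n).
    rewrite (eq_integral (fun w => (f w)%:E + D w) Z); last first.
      by move=> w _; rewrite addeC subeK.
    rewrite ge0_integralD//; last 2 first.
    - by move=> w _; rewrite lee_fin.
    - exact: measurable_funTS.
    rewrite -[X in _ <= X]adde0 leeD2lE// ge0_fin_numE//.
    by apply: integral_ge0 => w _; rewrite lee_fin.
  move/(ae_eq_integral_abs P (mA n) mD); apply: filterS => w Dw Aw.
  by case: (Aw); rewrite /= -sube_gt0 -/(D w) (Dw Aw) ltxx.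
have := ae_foralln Anull; apply: filterS => w nA.
rewrite leNgt; apply/negP => fZ.
have [n fn] : exists n : nat, (f w <= n%:R)%R.
  by exists (Num.bound (f w)); apply/ltW/archi_boundP.
exact: nA n (conj fZ fn).
Qed.

End sub_sigma_algebra.

(** * Histories and the first passage time *)

Section histories.
Context {d : measure_display} {Omega : measurableType d} {R : realType}.
Variable X : nat -> Omega -> R.
Hypothesis mX : forall t, measurable_fun setT (X t).

(** [history X t] is convertible to [<<s history_gen t >>]. Naming the
    generators gives access to the measurable type [g_sigma_algebraType]. *)
Definition history_gen t : set (set Omega) :=
  \big[setU/set0]_(i < t.+1) preimage_set_system setT (X i) measurable.

Lemma history_genP t A : history_gen t A <->
  exists2 s, (s <= t)%N & preimage_set_system setT (X s) measurable A.
Proof.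
rewrite /history_gen.
rewrite -(bigcup_mkord _ (fun i => preimage_set_system setT (X i) measurable)).
by split=> -[s st As]; exists s.
Qed.

Lemma history_measurable t : history X t `<=` (measurable : set (set Omega)).
Proof.
apply: smallest_sub; first exact: sigma_algebra_measurable.
by move=> _ /history_genP[s _ [B mB <-]]; apply: mX.
Qed.

Lemma history_mono s t : (s <= t)%N -> history X s `<=` history X t.
Proof.
move=> st; apply: sub_smallest2r; first exact: smallest_sigma_algebra.
move=> A /history_genP[u us Au]; apply/history_genP; exists u => //.
exact: leq_trans st.
Qed.

Lemma measurable_fun_history s t : (s <= t)%N ->
  measurable_fun [set: g_sigma_algebraType (history_gen t)]
    (X s : g_sigma_algebraType (history_gen t) -> R).
Proof.
move=> st _ B mB; apply: sub_sigma_algebra; apply/history_genP.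
by exists s => //; exists B.
Qed.

Variable a : R.

Definition survived t : set Omega :=
  [set w | forall s, (s <= t)%N -> (a <= X s w)%R].

Lemma survived_history t : history X t (survived t).
Proof.
have -> : survived t =
    \bigcap_(s in [set s | (s <= t)%N]) [set w | (a <= X s w)%R].
  by apply/seteqP; split.
apply: (@bigcap_measurableType _ (g_sigma_algebraType (history_gen t))) => s st.
have := measurable_fun_history st measurableT (measurable_itv `[a, +oo[).
by rewrite setTI preimage_itvcy.
Qed.

Lemma measurable_survived t : measurable (survived t).
Proof. exact: history_measurable (@survived_history t). Qed.

Lemma survivedS t w : survived t.+1 w -> survived t w.
Proof. by move=> + s st; apply; apply: leqW. Qed.

Lemma first_below_gt t w : t%:R%:E < first_below X a w <-> survived t w.
Proof.
split=> [tT s st|St].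
  rewrite leNgt; apply/negP => Xs; move: tT; apply/negP; rewrite -leNgt.
  apply: (@le_trans _ _ s%:R%:E); last by rewrite lee_fin ler_nat.
  by apply: ereal_inf_lbound; exists s.
apply: (@lt_le_trans _ _ t.+1%:R%:E); first by rewrite lte_fin ltr_nat.
apply/ereal_infP => _ [s Xs <-]; rewrite lee_fin ler_nat ltnNge.
by apply/negP => /St; rewrite leNgt Xs.
Qed.

Lemma first_below_ge t w : survived t w -> t.+1%:R%:E <= first_below X a w.
Proof.
move=> St; apply/ereal_infP => _ [s Xs <-]; rewrite lee_fin ler_nat ltnNge.
by apply/negP => /St; rewrite leNgt Xs.
Qed.

(** A random time with values in N and infinity counts the times before it. *)
Lemma first_below_series w :
  first_below X a w = \sum_(0 <= t <oo) (\1_(survived t) w)%:E.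
Proof.
have [[t Xt]|never] := pselect (exists t, (X t w < a)%R).
  pose n := ex_minn (ex_intro (fun t => X t w < a)%R t Xt).
  have [Xn nmin] : (X n w < a)%R /\ forall s, (X s w < a)%R -> (n <= s)%N.
    by rewrite /n; case: ex_minnP.
  have Sn s : (\1_(survived s) w : R)%:E = (s < n)%:R%:E.
    rewrite indicE; congr (nat_of_bool _)%:R%:E.
    apply/idP/idP => [|sn]; rewrite in_setE.
      rewrite ltnNge => +; apply: contraPN => ns /(_ _ ns).
      by rewrite leNgt Xn.
    move=> k ks; rewrite leNgt; apply/negP => /nmin; rewrite leqNgt.
    by rewrite (leq_ltn_trans ks sn).
  rewrite (nneseries_split 0 n)// add0n eseries0 ?adde0; last first.
    by move=> s ns _; rewrite Sn ltnNge ns.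
  rewrite (eq_big_nat _ _ (F2 := fun=> 1%:E)); last first.
    by move=> s /andP[_ sn]; rewrite Sn sn.
  rewrite sumEFin big_const_nat subn0 iter_addr_0.
  apply/eqP; rewrite eq_le; apply/andP; split.
    by apply: ereal_inf_lbound; exists n.
  by apply/ereal_infP => _ [s /nmin ns <-]; rewrite lee_fin ler_nat.
have S1 s : (\1_(survived s) w : R)%:E = 1.
  rewrite indicE mem_set// => k _; rewrite leNgt; apply/negP => Xk.
  by apply: never; exists k.
have -> : first_below X a w = +oo.
  apply/eq_infty => r; apply/ereal_infP => y [s Xs _].
  by case: never; exists s.
apply/esym/eq_infty => r; have [n rn] : exists n : nat, (r <= n%:R)%R.
  exists (Num.trunc r).+1; exact/ltW/truncnS_gt.
apply: (@le_trans _ _ (\sum_(0 <= t < n) (\1_(survived t) w)%:E)).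
  under eq_bigr do rewrite S1.
  by rewrite sumEFin big_const_nat subn0 iter_addr_0 lee_fin.
by apply: nneseries_lim_ge => s _ _; rewrite S1.
Qed.

End histories.

(** * The logarithmic potential *)

Lemma ln_potential_drop {R : realType} (a x y : R) :
  (0 < a)%R -> (a <= x)%R -> (a <= y)%R ->
  ((1 + ln (y / a)) + 1 <= (1 + ln (x / a)) + y / x)%R.
Proof.
move=> a0 ax ay; have x0 := lt_le_trans a0 ax; have y0 := lt_le_trans a0 ay.
rewrite !ln_div ?posrE//.
have := @le_ln1Dx R (y / x - 1).
rewrite [X in ln X](_ : _ = y / x)%R; last by ring.
rewrite ltrBrDl subrr divr_gt0// ln_div ?posrE// => /(_ isT).
lra.
Qed.

Section multiplicative_drift.
Context {d : measure_display} {Omega : measurableType d} {R : realType}.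
Variables (P : probability Omega R) (X : nat -> Omega -> R).
Hypothesis mX : forall t, measurable_fun setT (X t).
Variables a delta : R.
Hypotheses (a_gt0 : (0 < a)%R) (delta_gt0 : (0 < delta)%R).

Definition potential t w : R :=
  ((1 + ln (X t w / a)) * \1_(survived X a t) w)%R.

(** The inverse is written as a real power because its measurability is then
    immediate. *)
Definition weight t w : R := ((X t w) `^ (-1) * \1_(survived X a t) w)%R.

Lemma survived_gt0 t w : survived X a t w -> (0 < X t w)%R.
Proof. by move=> /(_ t (leqnn t)); apply: lt_le_trans. Qed.

Lemma potentialE t w : survived X a t w ->
  potential t w = (1 + ln (X t w / a))%R.
Proof. by move=> St; rewrite /potential indicE mem_set// mulr1. Qed.

Lemma potential0 t w : ~ survived X a t w -> potential t w = 0%R.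
Proof. by move=> St; rewrite /potential indicE memNset// mulr0. Qed.

Lemma weightE t w : survived X a t w -> weight t w = (X t w)^-1%R.
Proof.
move=> St; rewrite /weight indicE mem_set// mulr1 powR_inv1//.
exact/ltW/survived_gt0.
Qed.

Lemma weight0 t w : ~ survived X a t w -> weight t w = 0%R.
Proof. by move=> St; rewrite /weight indicE memNset// mulr0. Qed.

Lemma potential_ge1 t w : survived X a t w -> (1 <= potential t w)%R.
Proof.
move=> St; rewrite potentialE// lerDl ln_ge0// ler_pdivlMr// mul1r.
exact: St.
Qed.

Lemma potential_ge0 t w : (0 <= potential t w)%R.
Proof.
have [/potential_ge1|/potential0->//] := pselect (survived X a t w).
exact: le_trans.
Qed.

Lemma weight_ge0 t w : (0 <= weight t w)%R.
Proof. by rewrite mulr_ge0// powR_ge0. Qed.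

Local Notation past t := (g_sigma_algebraType (history_gen X t)).

Lemma measurable_weight t :
  measurable_fun [set: past t] (weight t : past t -> R).
Proof.
apply: measurable_funM; last first.
  by apply: measurable_indic; exact: (@survived_history _ _ _ X).
apply: (measurableT_comp (f := (@powR R ^~ (-1)%R))).
  exact: measurable_powR.
exact: measurable_fun_history.
Qed.

Lemma measurable_potential t :
  measurable_fun [set: past t] (potential t : past t -> R).
Proof.
apply: measurable_funM; last first.
  by apply: measurable_indic; exact: (@survived_history _ _ _ X).
apply: measurable_funD => //; apply: (measurableT_comp (f := @ln R)).
  exact: measurable_ln.
by apply: measurable_funM => //; exact: measurable_fun_history.
Qed.

(** If the process drops below [a] at time [t.+1], the whole potential, which
    is at least 1, is lost; otherwise [ln_potential_drop] applies. *)
Lemma potential_drop t w : (survived X a t w -> 0 <= X t.+1 w)%R ->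
  (potential t.+1 w)%:E + (\1_(survived X a t) w)%:E <=
  (potential t w)%:E + (weight t w)%:E * (EFin \o X t.+1)^\+ w.
Proof.
move=> X0; have [St|St] := pselect (survived X a t w); last first.
  rewrite potential0; last by move/survivedS.
  by rewrite potential0// weight0// indicE memNset// mul0e.
have -> : (EFin \o X t.+1)^\+ w = (X t.+1 w)%:E.
  by rewrite funeposE; apply/max_idPl; rewrite lee_fin X0.
rewrite -EFinM -!EFinD lee_fin.
rewrite indicE mem_set// weightE//.
have [St1|St1] := pselect (survived X a t.+1 w); last first.
  rewrite potential0// add0r (le_trans (potential_ge1 St))// lerDl.
  by rewrite mulr_ge0 ?X0// invr_ge0 ltW// survived_gt0.
rewrite !potentialE// [X in (_ <= _ + X)%R]mulrC.
by apply: ln_potential_drop => //; [exact: St|exact: St1].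
Qed.

(** Integrate [potential_drop] over [A], exchange [X t.+1] for its conditional
    expectation against [weight t], and bound the latter by the drift. The
    drift is used as [delta + Z / X t <= 1], with nonnegative terms on the left,
    so that it also covers [1 < delta]. *)
Lemma integral_potential_step t (E : Omega -> \bar R) A :
  {ae P, forall w, survived X a t w -> (0 <= X t.+1 w)%R} ->
  is_condexp P (history X t) (EFin \o X t.+1) E ->
  {ae P, forall w, survived X a t w ->
    (delta * X t w)%:E <= (X t w)%:E - E w} ->
  history X t A ->
  \int[P]_(w in A) (potential t.+1 w)%:E +
    delta%:E * \int[P]_(w in A) (\1_(survived X a t) w)%:E <=
  \int[P]_(w in A) (potential t w)%:E.
Proof.
move=> X0 [Zp [Zn [EZp EZn EE]]] drift hA.
have sG := history_measurable mX (t := t).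
have mA : measurable A by exact: sG.
have mY : measurable_fun setT (EFin \o X t.+1) by apply/measurable_EFinP.
have Yp0 w : 0 <= (EFin \o X t.+1)^\+ w by exact: funepos_ge0.
have Yn0 w : 0 <= (EFin \o X t.+1)^\- w by exact: funeneg_ge0.
have Zp0 := condexp_ge0_ae sG Yp0 EZp.
have Zn0 : {ae P, forall w, survived X a t w -> Zn w = 0}.
  apply: (condexp_ge0_null sG Yn0 (measurable_funeneg mY) EZn).
    exact: survived_history.
  apply: filterS X0 => w X0w /X0w X1; rewrite funenegE; apply/max_idPr.
  by rewrite /= lee_fin oppr_le0.
have EZp' := condexp_ge0_funepos sG Yp0 EZp.
have mZps := condexp_measurable EZp'.
have mZp := measurable_fun_sub sG mZps.
have mw : measurable_fun setT (weight t).
  by apply: (measurable_fun_sub sG); exact: measurable_weight.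
have mp s : measurable_fun setT (potential s).
  apply: (measurable_fun_sub (history_measurable mX (t := s))).
  exact: measurable_potential.
have mS : measurable (survived X a t) by exact: measurable_survived.
pose p s := \int[P]_(w in A) (potential s w)%:E.
pose q := \int[P]_(w in A) (\1_(survived X a t) w : R)%:E.
pose u := \int[P]_(w in A) ((weight t w)%:E * Zp^\+ w).
have q_fin : q \is a fin_num.
  rewrite /q integral_indic// fin_num_measure//; exact: measurableI.
have mpA s : measurable_fun A (fun w => (potential s w)%:E).
  by apply/measurable_EFinP; exact: measurable_funTS.
have p0 s w : A w -> 0 <= (potential s w)%:E.
  by move=> _; rewrite lee_fin potential_ge0.
have miA : measurable_fun A (fun w => (\1_(survived X a t) w : R)%:E).
  exact/measurable_EFinP/measurable_indic.
have i0 w : A w -> 0 <= (\1_(survived X a t) w : R)%:E.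
  by move=> _; rewrite lee_fin.
have mwA : measurable_fun A (fun w => (weight t w)%:E).
  by apply/measurable_EFinP; exact: measurable_funTS.
have mwYA : measurable_fun A
    (fun w => (weight t w)%:E * (EFin \o X t.+1)^\+ w).
  apply: emeasurable_funM => //.
  exact/measurable_funTS/measurable_funepos.
have wY0 w : A w -> 0 <= (weight t w)%:E * (EFin \o X t.+1)^\+ w.
  by move=> _; rewrite mule_ge0// lee_fin weight_ge0.
have mwZA : measurable_fun A (fun w => (weight t w)%:E * Zp^\+ w).
  by apply: emeasurable_funM => //; exact: measurable_funTS.
have wZ0 w : A w -> 0 <= (weight t w)%:E * Zp^\+ w.
  by move=> _; rewrite mule_ge0// lee_fin weight_ge0.
have drop : p t.+1 + q <= p t + u.
  have -> : u = \int[P]_(w in A) ((weight t w)%:E * (EFin \o X t.+1)^\+ w).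
    apply: (ge0_integral_mul_sub sG) => //.
    - exact: measurable_funepos.
    - by apply/measurable_EFinP; exact: measurable_weight.
    - by move=> w; rewrite lee_fin weight_ge0.
    - by case: EZp'.
  rewrite /p /q -!ge0_integralD//; do ?exact: p0.
  apply: ae_ge0_le_integral => //.
  - by move=> w Aw; rewrite adde_ge0 ?p0 ?i0.
  - exact: emeasurable_funD.
  - by move=> w Aw; rewrite adde_ge0 ?p0 ?wY0.
  - exact: emeasurable_funD.
  - by apply: filterS X0 => w Xw _; apply: potential_drop.
have save : delta%:E * q + u <= q.
  rewrite /q /u -ge0_integralZl_EFin//; last exact: ltW.
  have mdA : measurable_fun A
      (fun w => delta%:E * (\1_(survived X a t) w : R)%:E).
    exact: emeasurable_funM.
  have d0 w : A w -> 0 <= delta%:E * (\1_(survived X a t) w : R)%:E.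
    by move=> Aw; rewrite mule_ge0 ?i0// lee_fin ltW.
  rewrite -ge0_integralD//; apply: ae_ge0_le_integral => //.
  - by move=> w Aw; rewrite adde_ge0 ?d0 ?wZ0.
  - exact: emeasurable_funD.
  apply: filterS3 drift Zp0 Zn0 => w Dw Zpw Znw _.
  have [Sw|Sw] := pselect (survived X a t w); last first.
    by rewrite weight0// indicE memNset// mule0 mul0e adde0.
  rewrite weightE// indicE mem_set// mule1 funeposE (max_idPl Zpw).
  have := Dw Sw; rewrite EE Znw// sube0.
  (* an infinite conditional expectation contradicts the drift condition *)
  case: (Zp w) Zpw => [r _|_ /=|]; [|by []|by []].
  rewrite -EFinB lee_fin => Dr.
  rewrite -EFinM -EFinD lee_fin -lerBrDl ler_pdivrMl ?survived_gt0//.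
  by rewrite mulrBr mulr1 [X in (_ - X)%R]mulrC lerBrDr addrC -lerBrDr.
(* add drop and save, then cancel the finite terms q *)
have : (p t.+1 + delta%:E * q) + q <= p t + q.
  rewrite addeAC; apply: (le_trans (leeD2r _ drop)).
  by rewrite -addeA leeD2l// addeC.
by rewrite leeD2rE.
Qed.

Lemma integral_first_below_le (E : nat -> Omega -> \bar R) A :
  (forall t, {ae P, forall w, survived X a t w -> (0 <= X t.+1 w)%R}) ->
  (forall t, is_condexp P (history X t) (EFin \o X t.+1) (E t)) ->
  (forall t, {ae P, forall w, survived X a t w ->
    (delta * X t w)%:E <= (X t w)%:E - E t w}) ->
  history X 0 A ->
  delta%:E * \int[P]_(w in A) first_below X a w <=
  \int[P]_(w in A) (potential 0 w)%:E.
Proof.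
move=> X0 XE drift hA.
have mA : measurable A by exact: (history_measurable mX hA).
pose p t := \int[P]_(w in A) (potential t w)%:E.
pose q t := \int[P]_(w in A) (\1_(survived X a t) w : R)%:E.
have q0 t : 0 <= q t by apply: integral_ge0 => w _; rewrite lee_fin.
have dq0 t : 0 <= delta%:E * q t by rewrite mule_ge0// lee_fin ltW.
have telescope n : p n + \sum_(0 <= t < n) (delta%:E * q t) <= p 0%N.
  elim: n => [|n IHn]; first by rewrite big_nil adde0.
  rewrite big_nat_recr//= addeCA addeC; apply: le_trans IHn.
  apply: leeD2r; apply: (@integral_potential_step n (E n)) => //.
  exact: history_mono hA.
under eq_integral do rewrite first_below_series.
rewrite integral_nneseries//; last first.
  by move=> t; exact/measurable_EFinP/measurable_indic/measurable_survived.
rewrite -nneseriesZl//; last by move=> t _; exact: q0.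
apply: lime_le; first by apply: is_cvg_nneseries => t _ _; exact: dq0.
apply: nearW => n; apply: le_trans (telescope n).
rewrite leeDr//; apply: integral_ge0 => w _.
by rewrite lee_fin potential_ge0.
Qed.

End multiplicative_drift.

(** * The drift theorem *)

Theorem corollary11 (R : realType) (d : measure_display)
  (Omega : measurableType d) (P : probability Omega R)
  (X : nat -> {RV P >-> R}) (xmin : R) (xmin_gt0 : (0 < xmin)%R)
  (T : Omega -> \bar R) (T_def : T = first_below X xmin)
  (X0_ge : {ae P, forall w, (xmin <= X 0%N w)%R})
  (X_ge0 : forall t : nat, {ae P, forall w, t%:R%:E <= T w -> (0 <= X t w)%R})
  (delta : R) (delta_gt0 : (0 < delta)%R)
  (EX : nat -> Omega -> \bar R)
  (EX_def : forall t : nat,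
    is_condexp P (history X t) (fun w => (X t.+1 w)%:E) (EX t))
  (drift : forall t : nat, {ae P, forall w,
    t%:R%:E < T w -> (delta * X t w)%:E <= (X t w)%:E - EX t w})
  (ET : Omega -> \bar R)
  (ET_def : is_condexp P (history X 0) T ET) :
  {ae P, forall w, ET w <= ((1 + ln (X 0%N w / xmin)) / delta)%:E}.
Proof.
have mX t : measurable_fun setT (X t) by exact: measurable_funP.
pose Y (t : nat) : Omega -> R := X t.
have X1_ge0 t : {ae P, forall w, survived Y xmin t w -> (0 <= Y t.+1 w)%R}.
  apply: filterS (X_ge0 t.+1) => w Xw Sw; apply: Xw.
  by rewrite T_def; exact: first_below_ge.
have drift' t : {ae P, forall w, survived Y xmin t w ->
    (delta * Y t w)%:E <= (Y t w)%:E - EX t w}.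
  apply: filterS (drift t) => w Dw Sw; apply: Dw.
  by rewrite T_def; exact/first_below_gt.
have sG := @history_measurable _ _ _ Y mX 0%N.
have T0 w : 0 <= T w.
  by rewrite T_def; apply/ereal_infP => _ [t _ <-]; rewrite lee_fin.
case: ET_def => [Zp [Zn [EZp EZn ET_E]]].
have Zn0 := condexp_ge0_ae sG (funeneg_ge0 T) EZn.
pose f w := (potential Y xmin 0 w / delta)%R.
have Zf : {ae P, forall w, Zp w <= (f w)%:E}.
  apply: (ae_le_of_integral_le sG).
  - exact: condexp_measurable EZp.
  - by apply: measurable_funM => //; exact: measurable_potential.
  - by move=> w; rewrite divr_ge0 ?potential_ge0// ltW.
  move=> A hA; have mA := sG _ hA.
  case: EZp => _ ->//.
  rewrite (eq_integral (first_below Y xmin)); last first.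
    by move=> w _; rewrite funeposE T_def (max_idPl _)// -T_def.
  have -> : \int[P]_(w in A) (f w)%:E =
      \int[P]_(w in A) (delta^-1%:E * (potential Y xmin 0 w)%:E).
    by apply: eq_integral => w _; rewrite -EFinM mulrC.
  rewrite ge0_integralZl_EFin//; last 3 first.
  - by move=> w _; rewrite lee_fin potential_ge0.
  - apply/measurable_EFinP/measurable_funTS/(measurable_fun_sub sG).
    exact: measurable_potential.
  - by rewrite invr_ge0 ltW.
  rewrite lee_pdivlMl//.
  exact: (integral_first_below_le mX xmin_gt0 delta_gt0 X1_ge0 EX_def drift').
apply: filterS3 X0_ge Zn0 Zf => w X0w Znw Zfw.
(* Zn >= 0, so ET = Zp - Zn is at most Zp, also at infinite values *)
rewrite ET_E; apply: (@le_trans _ _ (Zp w)).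
  by rewrite -[leRHS]sube0 leeB.
apply: le_trans Zfw _; rewrite /f potentialE// => s.
by rewrite leqn0 => /eqP->.
Qed.
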